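(* Let $n\in\mathbb{N}$, let $[f]\in\mathcal{G}$ and fix a positive infinitesimal $\delta\in{}^*\mathbb{R}$. Then $[f]\in\mathcal{G}^0$ if and only if the following holds: for each $\mathfrak r\in\mathcal{N}_\delta$ there is $\mathfrak s\in\mathcal{N}_\delta$ such that if $\xi,\zeta\in B_\delta$ satisfy $|\xi-\zeta|<\mathfrak s$, then $|{}^*f(\xi)-{}^*f(\zeta)|<\mathfrak r$.
   Context: A sufficiently saturated nonstandard extension $X\mapsto{}^*X$ (at least an enlargement) is fixed. $\mathcal{G}=\mathcal{G}_{n,1}$ is the ring of germs at $0$ of arbitrary functions $f:(\mathbb{R}^n,0)\to(\mathbb{R},0)$ (defined on a neighborhood of $0$, $f(0)=0$), and $\mathcal{G}^0\subset\mathcal{G}$ is the subring of germs of functions continuous on a neighborhood of $0$. $B_\delta=\{\xi\in{}^*\mathbb{R}^n:|\xi|\le\delta\}$. $\mathcal{M}$ is the set of germs at $0$ of functions $m:\mathbb{R}_+\to\mathbb{R}_+$ with $\lim_{t\to0}m(t)=0$ and $m(r)<m(t)$ for all sufficiently small $0<r<t$. $\mathcal{N}_\delta=\{{}^*m(\delta):[m]\in\mathcal{M}\}$. *)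

(* Defs.v *)
From HB Require Import structures.
From mathcomp Require Import all_boot all_order all_algebra.
From mathcomp Require Import all_classical all_reals all_analysis.

Set Implicit Arguments.
Unset Strict Implicit.
Unset Printing Implicit Defensive.

Import Order.TTheory GRing.Theory Num.Theory.
Import numFieldNormedType.Exports.
Local Open Scope classical_set_scope.
Local Open Scope ring_scope.

(* The superstructure over a set B of individuals, stratified by sorts:
   individuals, ordered pairs, n-tuples and sets.  n-tuples are row vectors, so
   that over the reals [El R (Vec n Base)] is ['rV[R]_n]. *)
Inductive sort : Type :=
  | Base
  | Prod of sort & sort
  | Vec of nat & sort
  | Pow of sort.

Fixpoint El (B : Type) (s : sort) : Type :=
  match s with
  | Base => B
  | Prod s1 s2 => (El B s1 * El B s2)%type
  | Vec n s1 => 'rV[El B s1]_n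
  | Pow s1 => set (El B s1)
  end.

(* De Bruijn variables of sort s in a context of sorted variables. *)
Inductive var : seq sort -> sort -> Type :=
  | VZ (c : seq sort) (s : sort) : var (s :: c) s
  | VS (c : seq sort) (t s : sort) : var c s -> var (t :: c) s.

(* Formulas with bounded quantifiers.  [FAll A p] is "for all x in A, p", where
   x becomes variable 0 of p; constants enter as values of free variables. *)
Inductive formula : seq sort -> Type :=
  | FEq c s (x y : var c s) : formula c
  | FMem c s (x : var c s) (A : var c (Pow s)) : formula c
  | FPair c s t (z : var c (Prod s t)) (x : var c s) (y : var c t) : formula c
  | FCoord c n s (x : var c (Vec n s)) (i : 'I_n) (y : var c s) : formula c
  | FNot c (p : formula c) : formula c
  | FAnd c (p q : formula c) : formula c
  | FAll c s (A : var c (Pow s)) (p : formula (s :: c)) : formula c.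

Fixpoint env (B : Type) (c : seq sort) : Type :=
  match c with
  | [::] => unit
  | s :: c' => (El B s * env B c')%type
  end.

Fixpoint lookup (B : Type) (c : seq sort) (s : sort) (x : var c s) :
    env B c -> El B s :=
  match x in var c s return env B c -> El B s with
  | VZ _ _ => fun e => e.1
  | VS _ _ _ y => fun e => lookup y e.2
  end.

Fixpoint sat (B : Type) (c : seq sort) (p : formula c) : env B c -> Prop :=
  match p in formula c return env B c -> Prop with
  | FEq _ _ x y => fun e => lookup x e = lookup y e
  | FMem _ _ x A => fun e => (lookup A e : set _) (lookup x e)
  | FPair _ _ _ z x y => fun e => lookup z e = (lookup x e, lookup y e)
  | FCoord _ _ _ x i y => fun e => (lookup x e : 'rV_ _) ord0 i = lookup y e
  | FNot _ p => fun e => ~ sat p e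
  | FAnd _ p q => fun e => sat p e /\ sat q e
  | FAll _ _ A p => fun e => forall a, (lookup A e : set _) a -> sat p (a, e)
  end.

Fixpoint env_map (B B' : Type) (h : forall s, El B s -> El B' s)
    (c : seq sort) : env B c -> env B' c :=
  match c return env B c -> env B' c with
  | [::] => fun e => e
  | s :: c' => fun e => (h s e.1, env_map h e.2)
  end.

(* A map from the superstructure over B to the superstructure over a set
   [hbase] = *B, satisfying the transfer principle. *)
Record nonstandard_extension (B : Type) := NonstandardExtension {
  hbase : Type;
  star : forall s : sort, El B s -> El hbase s;
  star_setT : star (s := Pow Base) setT = setT;
  transfer : forall (c : seq sort) (p : formula c) (e : env B c),
    sat p e <-> sat p (env_map star e)
}.

Definition enlargement (B : Type) (N : nonstandard_extension B) : Prop :=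
  forall (s : sort) (F : set (set (El B s))),
    (forall G : set (set (El B s)), finite_set G -> G `<=` F ->
       \bigcap_(A in G) A !=set0) ->
    \bigcap_(A in F) (star N (s := Pow s) A) !=set0.

Section Hyperreals.
Variables (R : realType) (N : nonstandard_extension R).

Definition hreal : Type := El (hbase N) Base.
Definition hvec (n : nat) : Type := El (hbase N) (Vec n Base).

Definition hreal_of (x : R) : hreal := star N (s := Base) x.

(* The extension *f : *D -> *R of the function f : D -> R, that is, of the set
   of pairs (x, f x) with x in D; the value outside *D is irrelevant. *)
Definition hfun (s : sort) (D : set (El R s)) (f : El R s -> R)
    (x : El (hbase N) s) : hreal :=
  @xget {classic hreal} (hreal_of 0)
    [set y | star N (s := Pow (Prod s Base)) [set p | D p.1 /\ p.2 = f p.1]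
                    (x, y)].

Definition hlt (x y : hreal) : Prop :=
  star N (s := Pow (Prod Base Base)) [set p : R * R | p.1 < p.2] (x, y).
Definition hle (x y : hreal) : Prop :=
  star N (s := Pow (Prod Base Base)) [set p : R * R | p.1 <= p.2] (x, y).

(* The norm of 'rV[R]_n in the library is the sup norm. *)
Definition enorm (n : nat) (x : 'rV[R]_n) : R :=
  Num.sqrt (\sum_(i < n) x ord0 i ^+ 2).

Definition hnorm (n : nat) (x : hvec n) : hreal :=
  hfun (s := Vec n Base) setT (@enorm n) x.

(* |x - y| on *R^n and on *R, as extensions of the standard functions of the
   pair (x, y). *)
Definition hvdist (n : nat) (x y : hvec n) : hreal :=
  hfun (s := Prod (Vec n Base) (Vec n Base)) setT
    (fun p : 'rV[R]_n * 'rV[R]_n => enorm (p.1 - p.2)) (x, y).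
Definition hdist (x y : hreal) : hreal :=
  hfun (s := Prod Base Base) setT (fun p : R * R => `|p.1 - p.2|) (x, y).

Definition pos_infinitesimal (d : hreal) : Prop :=
  hlt (hreal_of 0) d /\ forall e : R, 0 < e -> hlt d (hreal_of e).

Definition hball (n : nat) (d : hreal) : set (hvec n) :=
  [set x | hle (hnorm x) d].

(* R_+ is the set of positive reals; the values of m elsewhere are junk. *)
Definition modulus (m : R -> R) : Prop :=
  [/\ forall t, 0 < t -> 0 < m t,
      m t @[t --> 0^'+] --> 0 &
      exists2 e : R, 0 < e & forall r t, 0 < r -> r < t -> t < e -> m r < m t].

Definition moduli_at (d : hreal) : set hreal :=
  [set hfun (s := Base) [set t : R | 0 < t] m d | m in modulus].

End Hyperreals.

Section Germs.
Variables (R : realType) (n : nat).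

(* Functions (R^n, 0) -> (R, 0) defined on a neighbourhood [lf_dom] of 0; the
   values of [lf_val] outside [lf_dom] are junk. *)
Record local_fun := LocalFun {
  lf_dom : set 'rV[R]_n;
  lf_val : 'rV[R]_n -> R;
  lf_dom_nbhs : nbhs (0 : 'rV[R]_n) lf_dom;
  lf_val0 : lf_val 0 = 0
}.

(* The germ of f as an equivalence class. *)
Definition germ (f : local_fun) : set local_fun :=
  [set g | \forall x \near (0 : 'rV[R]_n), lf_val f x = lf_val g x].

Definition continuous_near0 (f : local_fun) : Prop :=
  exists U : set 'rV[R]_n,
    [/\ nbhs (0 : 'rV[R]_n) U, U `<=` lf_dom f
      & {within U, continuous (lf_val f)}].

Definition continuous_germs : set (set local_fun) :=
  germ @` continuous_near0.

Definition hlocal (N : nonstandard_extension R) (f : local_fun)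
    (x : hvec N n) : hreal N :=
  hfun (s := Vec n Base) (lf_dom f) (lf_val f) x.

End Germs.

(* Main.v *)
From HB Require Import structures.
Require Import Defs.
From mathcomp Require Import all_boot all_order all_algebra.
From mathcomp Require Import all_classical all_reals all_analysis.

Set Implicit Arguments.
Unset Strict Implicit.
Unset Printing Implicit Defensive.

Import Order.TTheory GRing.Theory Num.Theory.
Import numFieldNormedType.Exports.
Local Open Scope classical_set_scope.
Local Open Scope ring_scope.

(** Let B_t be the closed Euclidean ball of radius t about 0.

    Suppose that f is continuous near 0, and let m be a modulus. Then f is
    uniformly continuous on some ball B_a ([continuous_germ_unif]), so every
    t > 0 admits a d > 0 such that points of B_a at distance less than d have
    images at distance less than m(t). Near 0, a d that serves for some r < t
    also serves for t because m increases there, and that monotonicity allows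
    the choices of d to be made by one modulus s
    ([modulus_below]). The standard statement that, for small t > 0, points of
    B_t closer than s(t) have images closer than m(t) is then transferred and
    read at t = delta ([transfer_modulus]).

    Suppose that f is not continuous on any neighbourhood of 0. Then every B_t
    contains a point where f, restricted to B_t, has a positive oscillation
    ([oscillation]). An oscillation found in B_r is also found in B_t for t > r,
    so [modulus_below] gives a modulus m with m(t) below an oscillation attained
    in B_t. For any modulus s, the standard statement that, for small t > 0, B_t
    contains two points closer than s(t) whose images differ by at least m(t) is
    read at t = delta ([transfer_oscillation]); no *s(delta) can therefore serve
    for the tolerance *m(delta).

    Transfer is only given for sorted formulas with bounded quantifiers, so it
    is first turned into rules for the extensions of sets ([hset]) and of graphs
    of functions ([hgraph]): Boolean operations, projections, composition,
    pairing and preimages.  A standard statement of the form S included in T,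
    with S and T built from these operations, is then extended by [hset_sub] and
    unfolded at the hyperreal point.

    A point that needs care is that a row vector of hyperreals is not, by
    definition, an element of the extension of the set of all real row vectors;
    [hsetT] proves that it is one. *)

(** * Extensions of sets and of graphs of functions *)

Local Notation sort := Defs.sort.

Local Notation x0 := (VZ _ _).
Local Notation x1 := (VS _ x0).
Local Notation x2 := (VS _ x1).
Local Notation x3 := (VS _ x2).
Local Notation x4 := (VS _ x3).
Local Notation x5 := (VS _ x4).
Local Notation x6 := (VS _ x5).
Local Notation x7 := (VS _ x6).
Local Notation x8 := (VS _ x7).
Local Notation x9 := (VS _ x8).
Local Notation x10 := (VS _ x9).
Local Notation x11 := (VS _ x10).
Local Notation x12 := (VS _ x11).

Local Notation FEx A p := (FNot (FAll A (FNot p))).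

(* In the formulas below a universally quantified clause, from p1, ..., pk
   infer q, is written as the denial of p1, ..., pk and not q. *)

Section Transfer.
Variables (R : realType) (N : nonstandard_extension R).
Local Notation E := (El R).
Local Notation H := (El (hbase N)).

Definition hset (s : sort) (A : set (E s)) : set (H s) := star N (s := Pow s) A.

Lemma hset_sub (s : sort) (A B : set (E s)) : A `<=` B -> hset A `<=` hset B.
Proof.
move=> AB; pose e : env R [:: Pow s; Pow s] := (A, (B, tt)).
exact: (proj1 (transfer N (FAll x0 (FMem x0 x2)) e) AB).
Qed.

Lemma hset_star (s : sort) (A : set (E s)) (x : E s) :
  A x -> hset A (star N x).
Proof.
move=> Ax; pose e : env R [:: s; Pow s] := (x, (A, tt)).
exact: (proj1 (transfer N (FMem x0 x1) e) Ax).
Qed.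

Lemma hset_pairT (s t : sort) (x : H s) (y : H t) :
  hset [set: E s] x -> hset [set: E t] y -> hset [set: E (Prod s t)] (x, y).
Proof.
move=> Hx Hy.
pose e : env R [:: Pow s; Pow t; Pow (Prod s t)] := (setT, (setT, (setT, tt))).
have := proj1 (transfer N
  (FAll x0 (FAll x2 (FEx x4 (FPair x0 x2 x1)))) e).
move=> /= /(_ (fun x _ y _ k => k (x, y) I erefl)) /(_ x Hx y Hy) P.
by apply: contrapT => nP; apply: P => z Pz ze; apply: nP; rewrite -ze.
Qed.

(** A formula that overwrites one coordinate does not have to quantify over n
    coordinates, and iterating the step outside the logic reaches every vector.
    The relation U between vectors that agree off i carries the remaining
    coordinates. *)
Lemma hset_vec_update (s : sort) (n : nat) (i : 'I_n) (x : H (Vec n s))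
    (y : H s) :
  hset [set: E s] = setT -> hset [set: E (Vec n s)] x ->
  exists x', [/\ hset [set: E (Vec n s)] x', (x' : 'rV_n) ord0 i = y &
    forall j, j != i -> (x' : 'rV_n) ord0 j = (x : 'rV_n) ord0 j].
Proof.
move=> HsT Hx.
pose U : set (E (Prod (Vec n s) (Vec n s))) :=
  [set z | forall j, j != i -> (z.2 : 'rV_n) ord0 j = (z.1 : 'rV_n) ord0 j].
have Hs u : hset [set: E s] u by rewrite HsT.
pose e : env R [:: Pow s; Pow (Vec n s); Pow (Prod (Vec n s) (Vec n s))] :=
  (setT, (setT, (U, tt))).
have /= := proj1 (transfer N
  (FAll x1 (FAll x1 (FNot (FAll x4 (FAll x4
    (FNot (FAnd (FPair x1 x3 x0) (FCoord x0 i x2)))))))) e).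
move=> /(_ _ x Hx y (Hs y)) P.
apply: contrapT => nx'; apply: P.
  move=> v _ a _.
  pose v' : 'rV_n := \row_j if j == i then a else (v : 'rV_n) ord0 j.
  move=> /(_ (v, v') _ v' I); apply; last by split=> //; rewrite mxE eqxx.
  by move=> j /= ji; rewrite mxE (negPf ji).
move=> z Uz x' Hx' [zE x'i]; apply: nx'; exists x'; split=> // j ji.
have /= := proj1 (transfer N
  (FAll x2 (FAll x1 (FAll x3 (FAll x4
    (FNot (FAnd (FPair x3 x1 x0)
      (FAnd (FCoord x1 j x2) (FNot (FCoord x0 j x2))))))))) e).
move=> /(_ _ z Uz ((x : 'rV_n) ord0 j) _ x Hx x' Hx') P; apply: contrapT => nj.
apply: P; last by split.
  move=> w Uw a _ v _ v' _ [wE [va]]; apply; rewrite -va.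
  by move: (Uw j ji); rewrite wE.
exact: Hs.
Qed.

(** Supplies the standard vector from which [hsetT] starts. *)
Fixpoint default (s : sort) : E s :=
  match s with
  | Base => 0
  | Prod s t => (default s, default t)
  | Vec n s => const_mx (default s)
  | Pow s => set0
  end.

(** The sorts that do not involve sets: over the others the extension of the
    full set consists of the internal sets only, and [hsetT] can fail. *)
Fixpoint first_order (s : sort) : bool :=
  match s with
  | Base => true
  | Prod s t => first_order s && first_order t
  | Vec n s => first_order s
  | Pow _ => false
  end.

(** Transfer bounds its quantifiers by extensions of standard sets; this is
    what lets them range over all pairs and vectors of hyperreals.  For vectors,
    start from a standard one and correct its coordinates one by one. *)
Lemma hsetT (s : sort) : first_order s -> hset [set: E s] = setT.
Proof.
elim: s => [_|s IHs t IHt|n s IHs|//] /=; first exact: star_setT.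
  move=> /andP[/IHs Hs /IHt Ht]; apply/seteqP; split=> // -[x y] _.
  by apply: hset_pairT; rewrite ?Hs ?Ht.
move=> /IHs Hs; apply/seteqP; split=> // y _.
have update k : (k <= n)%N -> exists x : H (Vec n s),
    hset [set: E (Vec n s)] x /\
    forall j : 'I_n, (j < k)%N -> (x : 'rV_n) ord0 j = (y : 'rV_n) ord0 j.
  elim: k => [_|k IHk kn].
    by exists (star N (default (Vec n s))); split=> //; exact: hset_star.
  have [x [Hx xy]] := IHk (ltnW kn).
  have [x' [Hx' x'k x'x]] :=
    hset_vec_update (Ordinal kn) ((y : 'rV_n) ord0 (Ordinal kn)) Hs Hx.
  exists x'; split=> // j; rewrite ltnS leq_eqVlt => /predU1P[jk|jk].
    by rewrite (_ : j = Ordinal kn) //; exact: val_inj.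
  by rewrite x'x ?xy //; apply: contraTN jk => /eqP ->; rewrite /= ltnn.
have [x [Hx xy]] := update n (leqnn n).
suff <- : x = y by [].
by apply/rowP => j; exact: xy.
Qed.

Lemma hsetC (s : sort) (A : set (E s)) : first_order s ->
  hset (~` A) = ~` hset A.
Proof.
move=> /hsetT sT.
pose e : env R [:: Pow s; Pow s; Pow s] := (setT, (A, (~` A, tt))).
have /= := proj1 (transfer N (FAll x0 (FAnd
  (FNot (FAnd (FMem x0 x2) (FMem x0 x3)))
  (FNot (FAnd (FNot (FMem x0 x2)) (FNot (FMem x0 x3)))))) e).
rewrite -/(hset A) -/(hset (~` A)) -/(hset setT) sT => P.
have {}P x : ~ (hset A x /\ hset (~` A) x) /\ ~ (~ hset A x /\ ~ hset (~` A) x).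
  by apply: P => // a _; split=> [[]//|[na]]; apply.
apply/seteqP; split=> x Ax; first by move=> nAx; case: (P x) => + _; apply.
by apply: contrapT => nAx; case: (P x) => _; apply.
Qed.

Lemma hsetI (s : sort) (A B : set (E s)) : hset (A `&` B) = hset A `&` hset B.
Proof.
apply/seteqP; split=> [x ABx|x [Ax Bx]].
  by split; move: x ABx; apply: hset_sub => x [].
pose e : env R [:: Pow s; Pow s; Pow s] := (A, (B, (A `&` B, tt))).
have /= := proj1 (transfer N
  (FAll x0 (FNot (FAnd (FMem x0 x2) (FNot (FMem x0 x3))))) e).
move=> P; apply: contrapT => nAB; apply: P Ax _ => [a Aa [Ba]|].
  by apply.
by split.
Qed.

(** Values of extended functions are described by a relation, since a function
    would require a default value in every sort. *)
Definition hgraph (s t : sort) (phi : E s -> E t) (x : H s) (y : H t) : Prop :=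
  hset (s := Prod s t) [set p | p.2 = phi p.1] (x, y).

(** This is how witnesses that exist for all standard parameters are obtained at
    a nonstandard parameter. *)
Lemma hset_proj (s t : sort) (A : set (E (Prod s t))) (y : H t) :
  hset [set y | exists x, A (x, y)] y -> exists x, hset A (x, y).
Proof.
move=> Hy; pose e : env R [:: Pow t; Pow s; Pow (Prod s t)] :=
  ([set y | exists x, A (x, y)], (setT, (A, tt))).
have /= := proj1 (transfer N
  (FAll x0 (FEx x2 (FEx x4 (FPair x0 x1 x2)))) e).
move=> /(_ _ y Hy) P; apply: contrapT => nA; apply: P.
  by move=> b [a Aab] /(_ a I); apply=> /(_ (a, b) Aab); apply.
move=> x _; apply=> z Az zE; apply: nA; exists x.
by rewrite -zE.
Qed.

(** On the extension of its domain a function agrees with the extension of any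
    total function that has the same values there, so partial functions can be
    handled through total ones. *)
Lemma hfun_graph (s : sort) (D : set (E s)) (f : E s -> R) (x : H s) :
  hset D x -> hgraph (t := Base) f x (hfun D f x).
Proof.
move=> Dx; pose G : set (E (Prod s Base)) := [set p | D p.1 /\ p.2 = f p.1].
have [y Gxy] : exists y, hset G (x, y).
  pose e : env R [:: Pow s; Pow Base; Pow (Prod s Base)] :=
    (D, (setT, (G, tt))).
  have /= := proj1 (transfer N
    (FAll x0 (FEx x2 (FEx x4 (FPair x0 x2 x1)))) e).
  move=> /(_ _ x Dx) P; apply: contrapT => nG; apply: P.
    by move=> a Da /(_ (f a) I); apply=> /(_ (a, f a)); apply.
  by move=> y _; apply=> z Gz zE; apply: nG; exists y; rewrite -zE.
have GxD : hset G (x, hfun D f x) :=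
  @xgetI {classic hreal N} _ [set y | hset G (x, y)] y Gxy.
by move: GxD; apply: hset_sub => p [].
Qed.

Section FirstOrder.
Variables (s t u : sort).
Hypotheses (Fs : first_order s) (Ft : first_order t) (Fu : first_order u).

Let Hs x : hset [set: E s] x. Proof. by rewrite hsetT. Qed.
Let Ht x : hset [set: E t] x. Proof. by rewrite hsetT. Qed.
Let Hu x : hset [set: E u] x. Proof. by rewrite hsetT. Qed.
Let Hst x : hset [set: E (Prod s t)] x. Proof. by rewrite hsetT//= Fs. Qed.
Let Hsu x : hset [set: E (Prod s u)] x. Proof. by rewrite hsetT//= Fs. Qed.
Let Htu x : hset [set: E (Prod t u)] x. Proof. by rewrite hsetT//= Ft. Qed.

Lemma hgraph_comp (phi : E s -> E t) (psi : E t -> E u) x y z :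
  hgraph phi x y -> hgraph psi y z -> hgraph (psi \o phi) x z.
Proof.
move=> xy yz; pose C : set (E (Prod s u)) := [set p | p.2 = psi (phi p.1)].
pose e : env R [:: Pow s; Pow t; Pow u; Pow (Prod s u); Pow (Prod s u);
    Pow (Prod s t); Pow (Prod t u)] := (setT, (setT, (setT, (setT,
  (C, ([set p | p.2 = phi p.1], ([set p | p.2 = psi p.1], tt))))))).
have /= := proj1 (transfer N (FAll x5 (FAll x7 (FAll x2 (FAll x4 (FAll x6
  (FAll x8 (FNot (FAnd (FPair x5 x3 x2) (FAnd (FPair x4 x2 x1)
  (FAnd (FPair x0 x3 x1) (FNot (FMem x0 x10)))))))))))) e).
move=> /(_ _ _ xy _ yz _ (Hs x) _ (Ht y) _ (Hu z) _ (Hsu (x, z))) P.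
apply: contrapT => nC; apply: P; last by [].
move=> p pphi q qpsi a _ b _ c _ v _ [pE [qE [vE]]]; apply.
by move: pphi qpsi; rewrite pE qE vE /C /= => -> ->.
Qed.

Lemma hgraph_pair (phi : E s -> E t) (psi : E s -> E u) x y z :
  hgraph phi x y -> hgraph psi x z ->
  hgraph (t := Prod t u) (fun x => (phi x, psi x)) x (y, z).
Proof.
move=> xy xz; pose C : set (E (Prod s (Prod t u))) :=
  [set p | p.2 = (phi p.1, psi p.1)].
have Hstu : hset [set: E (Prod s (Prod t u))] (x, (y, z)).
  by rewrite hsetT //= Fs Ft.
pose e : env R [:: Pow s; Pow t; Pow u; Pow (Prod t u); Pow (Prod s (Prod t u));
    Pow (Prod s (Prod t u)); Pow (Prod s t); Pow (Prod s u)] :=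
  (setT, (setT, (setT, (setT, (setT,
  (C, ([set p | p.2 = phi p.1], ([set p | p.2 = psi p.1], tt)))))))).
have /= := proj1 (transfer N (FAll x6 (FAll x8 (FAll x2 (FAll x4 (FAll x6
  (FAll x8 (FAll x10 (FNot (FAnd (FPair x6 x4 x3) (FAnd (FPair x5 x4 x2)
  (FAnd (FPair x1 x3 x2) (FAnd (FPair x0 x4 x1)
  (FNot (FMem x0 x12)))))))))))))) e).
move=> /(_ _ _ xy _ xz _ (Hs x) _ (Ht y) _ (Hu z) _ (Htu (y, z)) _ Hstu) P.
apply: contrapT => nC; apply: P; last by [].
move=> p pphi q qpsi a _ b _ c _ v _ w _ [pE [qE [vE [wE]]]]; apply.
by move: pphi qpsi; rewrite pE qE wE vE /C /= => -> ->.
Qed.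

Lemma hgraph_fst x y : hgraph (s := Prod s t) (t := s) fst (x, y) x.
Proof.
pose C : set (E (Prod (Prod s t) s)) := [set p | p.2 = p.1.1].
have Hsts : hset [set: E (Prod (Prod s t) s)] ((x, y), x).
  by rewrite hsetT //= Fs Ft.
pose e : env R [:: Pow (Prod s t); Pow s; Pow t; Pow (Prod (Prod s t) s);
  Pow (Prod (Prod s t) s)] := (setT, (setT, (setT, (setT, (C, tt))))).
have /= := proj1 (transfer N (FAll x0 (FAll x2 (FAll x4 (FAll x6 (FNot
  (FAnd (FPair x3 x2 x1) (FAnd (FPair x0 x3 x2) (FNot (FMem x0 x8))))))))) e).
move=> /(_ _ _ (Hst (x, y)) _ (Hs x) _ (Ht y) _ Hsts) P.
apply: contrapT => nC; apply: P; last by [].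
by move=> p _ a _ b _ v _ [pE [vE]]; apply; rewrite vE pE.
Qed.

Lemma hgraph_snd x y : hgraph (s := Prod s t) (t := t) snd (x, y) y.
Proof.
pose C : set (E (Prod (Prod s t) t)) := [set p | p.2 = p.1.2].
have Hstt : hset [set: E (Prod (Prod s t) t)] ((x, y), y).
  by rewrite hsetT //= Fs Ft.
pose e : env R [:: Pow (Prod s t); Pow s; Pow t; Pow (Prod (Prod s t) t);
  Pow (Prod (Prod s t) t)] := (setT, (setT, (setT, (setT, (C, tt))))).
have /= := proj1 (transfer N (FAll x0 (FAll x2 (FAll x4 (FAll x6 (FNot
  (FAnd (FPair x3 x2 x1) (FAnd (FPair x0 x3 x1) (FNot (FMem x0 x8))))))))) e).
move=> /(_ _ _ (Hst (x, y)) _ (Hs x) _ (Ht y) _ Hstt) P.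
apply: contrapT => nC; apply: P; last by [].
by move=> p _ a _ b _ v _ [pE [vE]]; apply; rewrite vE pE.
Qed.

Lemma hgraph_cst (c : E t) x : hgraph (fun _ : E s => c) x (star N c).
Proof.
pose C : set (E (Prod s t)) := [set p | p.2 = c].
pose e : env R [:: t; Pow s; Pow (Prod s t); Pow (Prod s t)] :=
  (c, (setT, (setT, (C, tt)))).
have /= := proj1 (transfer N (FAll x1 (FAll x3 (FNot
  (FAnd (FPair x0 x1 x2) (FNot (FMem x0 x5)))))) e).
move=> /(_ _ _ (Hs x) _ (Hst (x, star N c))) P.
apply: contrapT => nC; apply: P; last by [].
by move=> a _ v _ [vE]; apply; rewrite vE.
Qed.

(** One implication is transferred; the other is the same one for the
    complement. *)
Lemma hset_preimage (phi : E s -> E t) (A : set (E t)) x y :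
  hgraph phi x y -> (hset (phi @^-1` A) x <-> hset A y).
Proof.
move=> xy.
have pre (B : set (E t)) : hset B y -> hset (phi @^-1` B) x.
  move=> By; pose e : env R [:: Pow s; Pow t; Pow s; Pow (Prod s t)] :=
    (setT, (B, (phi @^-1` B, ([set p | p.2 = phi p.1], tt)))).
  have /= := proj1 (transfer N (FAll x3 (FAll x1 (FAll x3 (FNot
    (FAnd (FPair x2 x1 x0) (FNot (FMem x1 x5))))))) e).
  move=> /(_ _ _ xy _ (Hs x) _ By) P.
  apply: contrapT => nB; apply: P; last by [].
  by move=> p pphi a _ b Bb [pE]; apply; move: pphi Bb; rewrite pE /= => ->.
split; last exact: pre.
apply: contraPP => nA; have := pre (~` A); rewrite hsetC // preimage_setC.
by rewrite hsetC //; exact.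
Qed.
End FirstOrder.

(** The extension of a standard relation between two standard functions is read
    off from the values of these functions. *)
Lemma hset_rel (s t u : sort) (A : set (E (Prod t u)))
    (phi : E s -> E t) (psi : E s -> E u) x y z :
  first_order s -> first_order t -> first_order u ->
  hgraph phi x y -> hgraph psi x z ->
  (hset [set x | A (phi x, psi x)] x <-> hset A (y, z)).
Proof.
move=> Fs Ft Fu xy xz.
have Ftu : first_order (Prod t u) by rewrite /= Ft.
exact: (hset_preimage Fs Ftu A (hgraph_pair Fs Ft Fu xy xz)).
Qed.
End Transfer.

(** * Monotone choices of moduli *)

Section Modulus.
Variable R : realType.
Implicit Types P : R -> R -> Prop.

(** The supremum h(t) of the s satisfying P(t, s), truncated at 1, is
    positive, and nondecreasing near 0.  The product t h(t) is a modulus: the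
    factor t makes it strictly increasing near 0 and forces the limit 0, and for
    t < 1 it puts the value strictly below the supremum, hence below some s with
    P(t, s). *)
Lemma modulus_below P (e : R) : 0 < e ->
  (forall t, 0 < t -> exists2 s, 0 < s & P t s) ->
  (forall r t s, 0 < r -> r < t -> t < e -> P r s -> P t s) ->
  exists2 m, modulus m & forall t, 0 < t -> t < 1 -> exists2 s, m t < s & P t s.
Proof.
move=> e0 Pex Pmono.
(* P t need not be closed downwards; adding the smaller s makes the truncation
   at 1 keep A t nonempty. *)
pose A t := [set s | 0 < s <= 1 /\ exists2 s', s <= s' & P t s'].
have Asup t : 0 < t -> has_sup (A t).
  move=> t0; split; last by exists 1 => s [/andP[]].
  have [s s0 Pts] := Pex t t0; exists (Num.min s 1).
  split; first by rewrite lt_min s0 ltr01 ge_min lexx orbT.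
  by exists s => //; rewrite ge_min lexx.
have sup0 t : 0 < t -> 0 < sup (A t).
  move=> t0; have [[s As] ub] := Asup t t0; have [/andP[s0 _] _] := As.
  by apply: lt_le_trans s0 _; exact: ub_le_sup.
have sup1 t : 0 < t -> sup (A t) <= 1.
  by move=> t0; apply: ge_sup => [|s [/andP[]]//]; have [] := Asup t t0.
exists (fun t => t * sup (A t)).
  split=> [t t0|| ].
  - by rewrite mulr_gt0 // sup0.
  - apply/cvgr0Pnorm_lt => d d0; near=> t.
    have t0 : 0 < t by near: t; exact: nbhs_right_gt.
    rewrite gtr0_norm ?mulr_gt0 ?sup0 //.
    apply: (@le_lt_trans _ _ t); first by rewrite ler_piMr ?sup1 // ltW.
    by near: t; exact: nbhs_right_lt.
  - exists e => // r t r0 rt te; have t0 := lt_trans r0 rt.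
    apply: (@lt_le_trans _ _ (t * sup (A r))); first by rewrite ltr_pM2r ?sup0.
    rewrite ler_pM2l //; apply: le_sup.
    + move=> s [s01 [s' ss' Prs']]; exists s; split=> //; split=> //.
      by exists s' => //; exact: Pmono Prs'.
    + by have [] := Asup r r0.
    + exact: Asup.
move=> t t0 t1.
have lt_sup : t * sup (A t) < sup (A t) by rewrite gtr_pMl ?sup0.
have [s As /lt_le_trans] := sup_gt (proj1 (Asup t t0)) lt_sup.
by have [_ [s' ss' Pts']] := As; move=> /(_ _ ss') ?; exists s'.
Unshelve. all: by end_near. Qed.

End Modulus.

(** * The Euclidean norm and the topology of row vectors *)

Section EuclideanNorm.
Variables (R : realType) (n : nat).
Implicit Types x y : 'rV[R]_n.

Lemma coord_le_enorm x (i : 'I_n) : `|x ord0 i| <= enorm x.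
Proof.
rewrite -sqrtr_sqr ler_wsqrtr // (bigD1 i) //= lerDl sumr_ge0 // => j _.
exact: sqr_ge0.
Qed.

(** Crude comparison with the sup norm; dividing by n + 1 instead of sqrt n
    keeps the bound strict and covers n = 0. *)
Lemma enorm_lt x (e : R) : 0 < e ->
  (forall i, `|x ord0 i| < e / n.+1%:R) -> enorm x < e.
Proof.
move=> e0 xe; rewrite -[ltRHS]gtr0_norm // -sqrtr_sqr ltr_sqrt ?exprn_gt0 //.
apply: (@le_lt_trans _ _ (\sum_(i < n) (e / n.+1%:R) ^+ 2)).
  apply: ler_sum => i _; rewrite -real_normK ?num_real //.
  by rewrite lerXn2r ?nnegrE ?divr_ge0 ?(ltW e0) ?(ltW (xe i)).
rewrite sumr_const card_ord expr_div_n -[_ *+ n]mulr_natr mulrAC.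
rewrite ltr_pdivrMr ?exprn_gt0 // ltr_pM2l ?exprn_gt0 // -natrX ltr_nat.
by rewrite expnS expn1 (@leq_trans n.+1) // leq_pmulr.
Qed.

Lemma near_enorm x (e : R) : 0 < e -> \forall y \near x, enorm (x - y) < e.
Proof.
move=> e0; apply/nbhs_ballP; exists (e / n.+1%:R) => /=; first exact: divr_gt0.
move=> y [_ xy]; apply: enorm_lt => // i.
by rewrite !mxE; exact: xy.
Qed.

Lemma near0_enorm_le (e : R) : 0 < e ->
  \forall x \near (0 : 'rV[R]_n), enorm x <= e.
Proof.
move=> e0; apply/nbhs_ballP; exists (e / n.+1%:R) => /=; first exact: divr_gt0.
move=> y [_ xy]; apply/ltW/enorm_lt => // i.
by have := xy ord0 i; rewrite /ball /= mxE sub0r normrN.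
Qed.

Lemma nbhs0_enorm (A : set 'rV[R]_n) : nbhs (0 : 'rV[R]_n) A ->
  exists2 a, 0 < a & forall x, enorm x <= a -> A x.
Proof.
move=> /nbhs_ballP[d /= d0 dA]; exists (d / 2); first exact: divr_gt0.
move=> x xd; apply: dA; split=> // i j; rewrite ord1 /ball /= mxE sub0r normrN.
apply: le_lt_trans (coord_le_enorm _ _) (le_lt_trans xd _).
by rewrite ltr_pdivrMr // ltr_pMr // ltr1n.
Qed.

(** A cube rather than a ball, as compactness of a product is then immediate. *)
Lemma compact_cube (a : R) :
  compact [set x : 'rV[R]_n | forall i, `|x ord0 i| <= a].
Proof.
rewrite (_ : mkset _ =
  [set x : 'rV_n | forall i, `[- a, a]%classic (x ord0 i)]).
  apply: (@rV_compact _ n (fun=> `[- a, a]%classic)) => _.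
  exact: segment_compact.
by apply/seteqP; split=> x /= xa i; have := xa i; rewrite in_itv /= ler_norml.
Qed.

(** Only x has to lie in K because g is continuous at the points of K along the
    whole space. *)
Lemma heine_cantor (K : set 'rV[R]_n) (g : 'rV[R]_n -> R) (e : R) :
  compact K -> (forall x, K x -> {for x, continuous g}) -> 0 < e ->
  exists2 d, 0 < d &
    forall x y, K x -> enorm (x - y) < d -> `|g x - g y| < e.
Proof.
move=> /compact_near_coveringP cK gK e0.
pose P (d : R) (x : 'rV[R]_n) :=
  forall y, enorm (x - y) < d -> `|g x - g y| < e.
have : \forall d \near 0^'+, K `<=` P d.
  apply: cK => x Kx.
  have /cvgr_dist_lt/(_ _ (divr_gt0 e0 (ltr0n _ 2))) := gK x Kx.
  move=> /nbhs_ballP[r /= r0 rg]; exists (ball x (r / 2), [set d | d < r / 2]).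
    by split=> /=; [exact/nbhsx_ballx/divr_gt0|exact/nbhs_right_lt/divr_gt0].
  move=> [x' d] /= [xx' dr] y yd.
  rewrite -(subrKA (g x)) (le_lt_trans (ler_normD _ _)) // (splitr e) ltrD //.
    rewrite distrC; apply: rg; apply: le_ball xx'.
    by rewrite ler_pdivrMr // ler_pMr // ler1n.
  apply: rg; rewrite (splitr r); apply: ball_triangle xx' _.
  split=> [|i j]; first exact: divr_gt0.
  have := coord_le_enorm (x' - y) j; rewrite !mxE => x'y.
  rewrite ord1 /ball /=; exact: le_lt_trans x'y (lt_trans yd dr).
move=> H; near (0 : R)^'+ => d.
exists d; first by near: d; exact: nbhs_right_gt.
by move=> x y Kx; apply: (near H d).
Unshelve. all: by end_near. Qed.
End EuclideanNorm.

(** * Continuity of a germ in terms of balls about 0 *)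

Section GermContinuity.
Variables (R : realType) (n : nat).
Implicit Type f : local_fun R n.

(** A germ is continuous when some representative g is, so f and g have to be
    identified on a ball before uniform continuity of g on a cube is used. *)
Lemma continuous_germ_unif f : continuous_germs (germ f) ->
  exists a, [/\ 0 < a, forall x, enorm x <= a -> lf_dom f x &
    forall e, 0 < e -> exists2 d, 0 < d &
      forall x y, enorm x <= a -> enorm y <= a -> enorm (x - y) < d ->
        `|lf_val f x - lf_val f y| < e].
Proof.
move=> [g [U [U0 Ug cg]] gf].
have {}gf : \forall x \near (0 : 'rV[R]_n), lf_val g x = lf_val f x.
  suff : germ g f by [].
  by rewrite gf; near=> x.
have cgx : \forall x \near (0 : 'rV[R]_n), {for x, continuous (lf_val g)}.
  have := nbhs_interior U0; apply: filterS => x Ux.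
  have /subspace_continuousP/(_ x (interior_subset Ux)) := cg.
  by rewrite within_interior.
have [a a0 aP] := nbhs0_enorm
  (filterI (filterI gf (lf_dom_nbhs f)) cgx).
(* The cube of half-side b contains the ball of radius b and lies in the ball of
   radius a, where f = g and g is continuous at each point. *)
pose b := a / n.+1%:R / 2.
have b0 : 0 < b by rewrite !divr_gt0.
have ba (x : 'rV[R]_n) : (forall i : 'I_n, `|x ord0 i| <= b) -> enorm x <= a.
  move=> xb; apply/ltW/enorm_lt => // i; apply: le_lt_trans (xb i) _.
  by rewrite ltr_pdivrMr // ltr_pMr ?ltr1n // divr_gt0.
have bP (x : 'rV[R]_n) : enorm x <= b -> _ :=
  fun xb => aP x (ba x (fun i => le_trans (coord_le_enorm x i) xb)).
exists b; split=> // [x /bP[[]]//|e e0].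
have [|d d0 dP] := heine_cantor (g := lf_val g) (@compact_cube R n b) _ e0.
  by move=> x /ba/aP[].
exists d => // x y xb yb xy.
have [[<- _] _] := bP x xb; have [[<- _] _] := bP y yb.
by apply: dP => // i; exact: le_trans (coord_le_enorm x i) xb.
Unshelve. all: by end_near. Qed.

(** Otherwise f would be continuous on the part of the ball of radius t that
    lies in its domain, relative to that part, which is a neighbourhood of 0. *)
Lemma oscillation f : ~ continuous_near0 f -> forall t, 0 < t ->
  exists2 e, 0 < e & exists x, [/\ lf_dom f x, enorm x <= t &
    forall s, 0 < s -> exists y, [/\ lf_dom f y, enorm y <= t,
      enorm (x - y) < s & e <= `|lf_val f x - lf_val f y|]].
Proof.
move=> ncf t t0; apply: contrapT => nosc; apply: ncf.
exists (lf_dom f `&` [set x | enorm x <= t]); split.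
- by apply: filterI; [exact: lf_dom_nbhs|exact: near0_enorm_le].
- by move=> x [].
apply/subspace_continuousP => x [Dx xt]; apply/cvgrPdist_lt => e e0.
have [s s0 sP] : exists2 s, 0 < s & forall y, lf_dom f y -> enorm y <= t ->
    enorm (x - y) < s -> `|lf_val f x - lf_val f y| < e.
  apply: contrapT => ns; apply: nosc; exists e => //; exists x; split=> // s s0.
  apply: contrapT => ny; apply: ns; exists s => // y Dy yt xy.
  by rewrite ltNge; apply/negP => ey; apply: ny; exists y.
rewrite near_withinE; near=> y => -[Dy yt]; apply: sP => //.
by near: y; exact: near_enorm.
Unshelve. all: by end_near. Qed.

End GermContinuity.

(** * Reading standard statements at a hyperreal configuration *)

(** The conditions to be transferred concern two vectors and a radius; they are
    sets of elements of sort Q, and their extensions are read at the point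
    ((xi, zeta), delta). *)
Section Configuration.
Variables (R : realType) (N : nonstandard_extension R) (n : nat).
Variables (f : local_fun R n) (m : R -> R).
Variables (xi zeta : hvec N n) (delta : hreal N).
Local Notation V := (Vec n Base).
Local Notation V2 := (Prod V V).
Local Notation R2 := (Prod Base Base).
Local Notation Q := (Prod V2 Base).
Local Notation Rpos := [set t : R | 0 < t].
Local Notation Lt := ([set p | p.1 < p.2] : set (El R R2)).
Local Notation Le := ([set p | p.1 <= p.2] : set (El R R2)).
Let q : El (hbase N) Q := ((xi, zeta), delta).
Hypothesis delta0 : hset (N := N) (s := Base) Rpos delta.

Let qpair : hgraph (s := Q) (t := V2) fst q (xi, zeta).
Proof. exact: (hgraph_fst (s := V2) (t := Base)). Qed.

Lemma config_left : hgraph (s := Q) (t := V) (fun p => p.1.1) q xi.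
Proof.
exact: (hgraph_comp (s := Q) (t := V2) (u := V) isT isT isT qpair
  (hgraph_fst (s := V) (t := V) isT isT xi zeta)).
Qed.

Lemma config_right : hgraph (s := Q) (t := V) (fun p => p.1.2) q zeta.
Proof.
exact: (hgraph_comp (s := Q) (t := V2) (u := V) isT isT isT qpair
  (hgraph_snd (s := V) (t := V) isT isT xi zeta)).
Qed.

Lemma config_scale : hgraph (s := Q) (t := Base) snd q delta.
Proof. exact: (hgraph_snd (s := V2) (t := Base)). Qed.

Let hfunT (s : sort) (g : El R s -> R) (x : El (hbase N) s) : first_order s ->
  hgraph (t := Base) g x (hfun setT g x).
Proof. by move=> Fs; apply: hfun_graph; rewrite hsetT. Qed.

Let qm : hgraph (s := Q) (t := Base) (fun p => m p.2) q
  (hfun (s := Base) Rpos m delta).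
Proof.
exact: (hgraph_comp (s := Q) (t := Base) (u := Base) isT isT isT config_scale
  (hfun_graph (s := Base) m delta0)).
Qed.

Lemma config_ball_left :
  hset (N := N) (s := Q) [set p | enorm p.1.1 <= p.2] q <-> hball delta xi.
Proof.
have xnorm := hgraph_comp (s := Q) (t := V) (u := Base) isT isT isT config_left
  (hfunT (s := V) (@enorm R n) xi isT).
exact: (hset_rel (s := Q) (t := Base) (u := Base) Le isT isT isT
  xnorm config_scale).
Qed.

Lemma config_ball_right :
  hset (N := N) (s := Q) [set p | enorm p.1.2 <= p.2] q <-> hball delta zeta.
Proof.
have ynorm := hgraph_comp (s := Q) (t := V) (u := Base) isT isT isT config_right
  (hfunT (s := V) (@enorm R n) zeta isT).
exact: (hset_rel (s := Q) (t := Base) (u := Base) Le isT isT isT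
  ynorm config_scale).
Qed.

Lemma config_close :
  hset (N := N) (s := Q) [set p | enorm (p.1.1 - p.1.2) < m p.2] q <->
  hlt (hvdist xi zeta) (hfun (s := Base) Rpos m delta).
Proof.
have dist := hgraph_comp (s := Q) (t := V2) (u := Base) isT isT isT qpair
  (hfunT (s := V2) (fun p : 'rV_n * 'rV_n => enorm (p.1 - p.2)) (xi, zeta) isT).
exact: (hset_rel (s := Q) (t := Base) (u := Base) Lt isT isT isT dist qm).
Qed.

Lemma config_dom_left :
  hset (N := N) (s := Q) [set p | lf_dom f p.1.1] q <->
  hset (s := V) (lf_dom f) xi.
Proof.
exact: (hset_preimage (s := Q) (t := V) isT isT (lf_dom f) config_left).
Qed.

Lemma config_dom_right :
  hset (N := N) (s := Q) [set p | lf_dom f p.1.2] q <->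
  hset (s := V) (lf_dom f) zeta.
Proof.
exact: (hset_preimage (s := Q) (t := V) isT isT (lf_dom f) config_right).
Qed.

Lemma config_image : hset (N := N) (s := V) (lf_dom f) xi ->
  hset (N := N) (s := V) (lf_dom f) zeta ->
  hset (N := N) (s := Q)
    [set p | `|lf_val f p.1.1 - lf_val f p.1.2| < m p.2] q <->
  hlt (hdist (hlocal f xi) (hlocal f zeta)) (hfun (s := Base) Rpos m delta).
Proof.
move=> Dxi Dzeta.
have fxi := hgraph_comp (s := Q) (t := V) (u := Base) isT isT isT config_left
  (hfun_graph (s := V) (lf_val f) Dxi).
have fzeta := hgraph_comp (s := Q) (t := V) (u := Base) isT isT isT config_right
  (hfun_graph (s := V) (lf_val f) Dzeta).
have fpair := hgraph_pair (s := Q) (t := Base) (u := Base) isT isT isT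
  fxi fzeta.
have dist := hgraph_comp (s := Q) (t := R2) (u := Base) isT isT isT fpair
  (hfunT (s := R2) (fun p : R * R => `|p.1 - p.2|) _ isT).
exact: (hset_rel (s := Q) (t := Base) (u := Base) Lt isT isT isT dist qm).
Qed.
End Configuration.

(** * Transfer at the infinitesimal radius *)

Section Main.
Variables (R : realType) (N : nonstandard_extension R) (n : nat).
Variables (f : local_fun R n) (delta : hreal N).
Hypothesis delta_inf : pos_infinitesimal delta.
Local Notation V := (Vec n Base).
Local Notation Q := (Prod (Prod V V) Base).

(** The two inequalities about delta concern constants, which [hset_rel] treats
    as values of functions; the pair (delta, delta) only supplies the second
    projection, whose value at it is delta. *)
Lemma infinitesimal_itv (a : R) : 0 < a ->
  hset (N := N) (s := Base) [set t | 0 < t /\ t < a] delta.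
Proof.
move=> a0; have [delta0 /(_ a a0) deltaa] := delta_inf.
pose B2 := Prod Base Base.
have dsnd := @hgraph_snd R N Base Base isT isT delta delta.
have cst c := @hgraph_cst R N B2 Base isT isT c (delta, delta).
apply: (proj1 (@hset_preimage R N B2 Base isT isT snd _ _ _ dsnd)).
rewrite (_ : _ @^-1` _ = [set p : R * R | 0 < p.2] `&` [set p | p.2 < a]) //.
rewrite (@hsetI R N B2); split.
  exact: (proj2 (@hset_rel R N B2 Base Base [set p | p.1 < p.2] _ _ _ _ _
    isT isT isT (cst 0) dsnd) delta0).
exact: (proj2 (@hset_rel R N B2 Base Base [set p | p.1 < p.2] _ _ _ _ _
  isT isT isT dsnd (cst a)) deltaa).
Qed.

Let pos_delta : hset (N := N) (s := Base) [set t | 0 < t] delta.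
Proof.
by have := infinitesimal_itv ltr01; apply: hset_sub => t [].
Qed.

Lemma transfer_modulus (a : R) (m s : R -> R) : 0 < a ->
  (forall x, enorm x <= a -> lf_dom f x) ->
  (forall t x y, 0 < t -> t < a -> enorm x <= t -> enorm y <= t ->
     enorm (x - y) < s t -> `|lf_val f x - lf_val f y| < m t) ->
  forall xi zeta : hvec N n, hball delta xi -> hball delta zeta ->
    hlt (hvdist xi zeta) (hfun (s := Base) [set t | 0 < t] s delta) ->
    hlt (hdist (hlocal f xi) (hlocal f zeta))
      (hfun (s := Base) [set t | 0 < t] m delta).
Proof.
move=> a0 aD std xi zeta xi_ball zeta_ball xi_zeta.
pose q : El (hbase N) Q := ((xi, zeta), delta).
pose S : set (El R Q) := [set p | enorm p.1.1 <= p.2] `&`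
  [set p | enorm p.1.2 <= p.2] `&` [set p | 0 < p.2 /\ p.2 < a].
have Sq : hset (N := N) S q.
  rewrite 2!(@hsetI R N Q); split; first split.
  - exact: (proj2 (config_ball_left xi zeta delta)).
  - exact: (proj2 (config_ball_right xi zeta delta)).
  - exact: (proj2 (@hset_preimage R N Q Base isT isT snd _ _ _
      (config_scale xi zeta delta)) (infinitesimal_itv a0)).
have Sa x t : enorm x <= t -> 0 < t /\ t < a -> lf_dom f x.
  by move=> xt [_ ta]; apply: aD; exact/ltW/(le_lt_trans xt).
have Dxi : hset (N := N) (s := V) (lf_dom f) xi.
  apply: (proj1 (config_dom_left f xi zeta delta)).
  by move: Sq; apply: hset_sub => p [[xt _]]; exact: Sa.
have Dzeta : hset (N := N) (s := V) (lf_dom f) zeta.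
  apply: (proj1 (config_dom_right f xi zeta delta)).
  by move: Sq; apply: hset_sub => p [[_ yt]]; exact: Sa.
apply: (proj1 (config_image m pos_delta Dxi Dzeta)).
have close := proj2 (config_close s xi zeta pos_delta) xi_zeta.
have : hset (N := N) (s := Q)
    (S `&` [set p | enorm (p.1.1 - p.1.2) < s p.2]) q.
  by rewrite (@hsetI R N Q).
apply: hset_sub => p [[[xt yt] [t0 ta]] xy].
exact: std ta xt yt xy.
Qed.

(** The radius d of the standard hypothesis is instantiated by s(t), after which
    the pair of witnesses depends on t alone and [hset_proj] applies. *)
Lemma transfer_oscillation (m s : R -> R) : (forall t, 0 < t -> 0 < s t) ->
  (forall t d, 0 < t -> t < 1 -> 0 < d -> exists x y,
     [/\ lf_dom f x /\ lf_dom f y, enorm x <= t, enorm y <= t,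
         enorm (x - y) < d & m t <= `|lf_val f x - lf_val f y|]) ->
  exists xi zeta : hvec N n,
    [/\ hball delta xi, hball delta zeta,
        hlt (hvdist xi zeta) (hfun (s := Base) [set t | 0 < t] s delta) &
        ~ hlt (hdist (hlocal f xi) (hlocal f zeta))
            (hfun (s := Base) [set t | 0 < t] m delta)].
Proof.
move=> s0 std.
pose D : set (El R Q) := [set p | lf_dom f p.1.1] `&` [set p | lf_dom f p.1.2].
pose B : set (El R Q) := [set p | enorm p.1.1 <= p.2] `&`
  [set p | enorm p.1.2 <= p.2].
pose C : set (El R Q) := [set p | enorm (p.1.1 - p.1.2) < s p.2] `&`
  ~` [set p | `|lf_val f p.1.1 - lf_val f p.1.2| < m p.2].
have [|[xi zeta]] := @hset_proj R N (Prod V V) Base (D `&` (B `&` C)) delta.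
  have := infinitesimal_itv ltr01; apply: hset_sub => t [t0 t1].
  have [x [y [[Dx Dy] xt yt xy fxy]]] := std t (s t) t0 t1 (s0 t t0).
  exists (x, y); split=> //; split=> //; split=> //=.
  by apply/negP; rewrite -leNgt.
rewrite !(@hsetI R N Q) (@hsetC R N Q) //.
move=> -[[Dxi Dzeta] [[xi_d zeta_d] [close far]]].
exists xi, zeta; split.
- exact: (proj1 (config_ball_left xi zeta delta)).
- exact: (proj1 (config_ball_right xi zeta delta)).
- exact: (proj1 (config_close s xi zeta pos_delta)).
- move=> near_val; apply: far.
  apply: (proj2 (config_image m pos_delta _ _)) near_val.
    exact: (proj1 (config_dom_left f xi zeta delta)).
  exact: (proj1 (config_dom_right f xi zeta delta)).
Qed.
End Main.

Theorem proposition4p7 (R : realType) (N : nonstandard_extension R)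
  (N_enl : enlargement N) (n : nat) (f : local_fun R n)
  (delta : hreal N) (delta_inf : pos_infinitesimal delta) :
  continuous_germs (R := R) (n := n) (germ f) <->
  (forall r : hreal N, moduli_at delta r ->
   exists s : hreal N, moduli_at delta s /\
     forall xi zeta : hvec N n,
       hball (n := n) delta xi -> hball (n := n) delta zeta ->
       hlt (hvdist xi zeta) s ->
       hlt (hdist (hlocal f xi) (hlocal f zeta)) r).
Proof.
split=> [/continuous_germ_unif[a [a0 aD unif]] _ [m [m0 _ [e e0 m_incr]] <-]|H].
  (* The admissible distances d for the tolerance m t. *)
  pose P t d := forall x y, enorm x <= a -> enorm y <= a -> enorm (x - y) < d ->
    `|lf_val f x - lf_val f y| < m t.
  have [t /m0/unif[d d0 dP]|r t d r0 rt te Prd x y xa ya xy|s smod sP] :=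
      @modulus_below R P e e0; [by exists d| |].
    exact: lt_trans (Prd x y xa ya xy) (m_incr r t r0 rt te).
  exists (hfun (s := Base) [set t | 0 < t] s delta); split; first by exists s.
  apply: (@transfer_modulus R N n f delta delta_inf (Num.min a 1)).
  - by rewrite lt_min a0 ltr01.
  - by move=> x; rewrite le_min => /andP[/aD].
  - move=> t x y t0; rewrite lt_min => /andP[ta t1] xt yt xy.
    have [d sd Ptd] := sP t t0 t1.
    apply: Ptd (lt_trans xy sd); exact: le_trans (ltW ta).
suff : continuous_near0 f by exists f.
apply: contrapT => ncf.
(* The oscillations e attained in the ball of radius t. *)
pose P t e := exists x, [/\ lf_dom f x, enorm x <= t &
  forall s, 0 < s -> exists y, [/\ lf_dom f y, enorm y <= t,
    enorm (x - y) < s & e <= `|lf_val f x - lf_val f y|]].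
have [t t0|r t e r0 /ltW rt _ [x [Dx xr xP]]|m mmod mP] :=
  @modulus_below R P 1 ltr01.
- exact: oscillation.
- exists x; split=> // [|s /xP[y [Dy yr xy ey]]]; first exact: le_trans rt.
  by exists y; split=> //; exact: le_trans rt.
have [_ [[s smod <-] sP]] := H _ (ex_intro2 _ _ m mmod erefl).
have [|t d t0 t1 d0|xi [zeta [xi_d zeta_d close far]]] :=
    @transfer_oscillation R N n f delta delta_inf m s.
- by case: smod.
- have [e me [x [Dx xt /(_ d d0)[y [Dy yt xy ey]]]]] := mP t t0 t1.
  by exists x, y; split=> //; exact: le_trans (ltW me) ey.
- by apply: far; exact: sP.
Qed.
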